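(* Derivability in $\mathsf{G3DM}$ is decidable: there is an algorithm which, given a DM-sequent $\Sigma\Rightarrow\varphi$, decides whether $\mathsf{G3DM}\vdash\Sigma\Rightarrow\varphi$.
   Context: Let $\Xi=\{p_n\mid n\in\omega\}$ be a denumerable set of propositional variables. Terms are generated by $\varphi::=p\mid\bot\mid{\sim}\varphi\mid(\varphi\wedge\varphi)\mid(\varphi\vee\varphi)$ with $p\in\Xi$. A DM-structure is a finite multiset of terms; the comma denotes multiset union. A DM-sequent is $\Sigma\Rightarrow\varphi$ with $\Sigma$ a DM-structure and $\varphi$ a term. The calculus $\mathsf{G3DM}$ (with $p\in\Xi$, all Greek lowercase letters arbitrary terms, $\Sigma$ an arbitrary DM-structure) has axioms: $p,\Sigma\Rightarrow p$; ${\sim}p,\Sigma\Rightarrow{\sim}p$; $\bot,\Sigma\Rightarrow\varphi$; $\Sigma\Rightarrow{\sim}\bot$. Rules: from $\varphi,\psi,\Sigma\Rightarrow\chi$ infer $\varphi\wedge\psi,\Sigma\Rightarrow\chi$; from $\Sigma\Rightarrow\varphi$ and $\Sigma\Rightarrow\psi$ infer $\Sigma\Rightarrow\varphi\wedge\psi$; from $\varphi,\Sigma\Rightarrow\chi$ and $\psi,\Sigma\Rightarrow\chi$ infer $\varphi\vee\psi,\Sigma\Rightarrow\chi$; from $\Sigma\Rightarrow\varphi_i$ ($i=1$ or $2$) infer $\Sigma\Rightarrow\varphi_1\vee\varphi_2$; from ${\sim}\varphi,\Sigma\Rightarrow\chi$ and ${\sim}\psi,\Sigma\Rightarrow\chi$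 infer ${\sim}(\varphi\wedge\psi),\Sigma\Rightarrow\chi$; from $\Sigma\Rightarrow{\sim}\varphi_i$ ($i=1$ or $2$) infer $\Sigma\Rightarrow{\sim}(\varphi_1\wedge\varphi_2)$; from ${\sim}\varphi,{\sim}\psi,\Sigma\Rightarrow\chi$ infer ${\sim}(\varphi\vee\psi),\Sigma\Rightarrow\chi$; from $\Sigma\Rightarrow{\sim}\varphi$ and $\Sigma\Rightarrow{\sim}\psi$ infer $\Sigma\Rightarrow{\sim}(\varphi\vee\psi)$; from $\varphi,\Sigma\Rightarrow\chi$ infer ${\sim}{\sim}\varphi,\Sigma\Rightarrow\chi$; from $\Sigma\Rightarrow\varphi$ infer $\Sigma\Rightarrow{\sim}{\sim}\varphi$. $\mathsf{G3DM}\vdash\Sigma\Rightarrow\varphi$ means that $\Sigma\Rightarrow\varphi$ has a derivation from these axioms by these rules. *)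

(* Defs.v *)
From HB Require Import structures.
From Stdlib Require Import Relation_Operators.
From mathcomp Require Import all_boot finmap multiset.

Set Implicit Arguments.
Unset Strict Implicit.
Unset Printing Implicit Defensive.

Local Open Scope mset_scope.

Inductive term : Type :=
| Var of nat
| Bot
| Neg of term
| And of term & term
| Or of term & term.

Fixpoint tree_of_term (t : term) : GenTree.tree nat :=
  match t with
  | Var n => GenTree.Leaf n
  | Bot => GenTree.Node 0 [::]
  | Neg a => GenTree.Node 1 [:: tree_of_term a]
  | And a b => GenTree.Node 2 [:: tree_of_term a; tree_of_term b]
  | Or a b => GenTree.Node 3 [:: tree_of_term a; tree_of_term b]
  end.

Fixpoint term_of_tree (t : GenTree.tree nat) : term :=
  match t with
  | GenTree.Leaf n => Var n
  | GenTree.Node 1 [:: a] => Neg (term_of_tree a)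
  | GenTree.Node 2 [:: a; b] => And (term_of_tree a) (term_of_tree b)
  | GenTree.Node 3 [:: a; b] => Or (term_of_tree a) (term_of_tree b)
  | _ => Bot
  end.

Lemma tree_of_termK : cancel tree_of_term term_of_tree.
Proof. by elim=> //= [a ->|a -> b ->|a -> b ->]. Qed.

HB.instance Definition _ := Countable.copy term (can_type tree_of_termK).

Definition structure : Type := {mset term}.

Definition sequent : Type := (structure * term)%type.

Declare Scope sequent_scope.
Delimit Scope sequent_scope with seqt.
Notation "S =>> a" := ((S, a) : sequent) (at level 70) : sequent_scope.
Local Open Scope sequent_scope.

(* [a +` S] is the multiset [S] with one more occurrence of [a]. *)
Inductive G3DM : sequent -> Prop :=
| ax_var p (S : structure) : G3DM (Var p +` S =>> Var p)
| ax_neg_var p (S : structure) : G3DM (Neg (Var p) +` S =>> Neg (Var p))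
| ax_bot (S : structure) a : G3DM (Bot +` S =>> a)
| ax_neg_bot (S : structure) : G3DM (S =>> Neg Bot)
| and_left (a b c : term) (S : structure) :
    G3DM (a +` (b +` S) =>> c) -> G3DM (And a b +` S =>> c)
| and_right a b (S : structure) :
    G3DM (S =>> a) -> G3DM (S =>> b) -> G3DM (S =>> And a b)
| or_left (a b c : term) (S : structure) :
    G3DM (a +` S =>> c) -> G3DM (b +` S =>> c) -> G3DM (Or a b +` S =>> c)
| or_right1 a b (S : structure) : G3DM (S =>> a) -> G3DM (S =>> Or a b)
| or_right2 a b (S : structure) : G3DM (S =>> b) -> G3DM (S =>> Or a b)
| neg_and_left a b c (S : structure) :
    G3DM (Neg a +` S =>> c) -> G3DM (Neg b +` S =>> c) ->
    G3DM (Neg (And a b) +` S =>> c)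
| neg_and_right1 a b (S : structure) :
    G3DM (S =>> Neg a) -> G3DM (S =>> Neg (And a b))
| neg_and_right2 a b (S : structure) :
    G3DM (S =>> Neg b) -> G3DM (S =>> Neg (And a b))
| neg_or_left a b c (S : structure) :
    G3DM (Neg a +` (Neg b +` S) =>> c) -> G3DM (Neg (Or a b) +` S =>> c)
| neg_or_right a b (S : structure) :
    G3DM (S =>> Neg a) -> G3DM (S =>> Neg b) -> G3DM (S =>> Neg (Or a b))
| neg_neg_left (a c : term) (S : structure) :
    G3DM (a +` S =>> c) -> G3DM (Neg (Neg a) +` S =>> c)
| neg_neg_right a (S : structure) :
    G3DM (S =>> a) -> G3DM (S =>> Neg (Neg a)).

(* A Rocq statement such as [{P} + {~ P}] or [exists f : T -> bool, ...] holds
   for every predicate once classical axioms are assumed, so algorithms are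
   taken in an explicit Turing-complete model: the weak call-by-value
   lambda-calculus "L" (Forster & Smolka, ITP 2017), with de Bruijn indices. *)

Inductive lterm : Type :=
| LVar of nat
| LApp of lterm & lterm
| LLam of lterm.

(* All occurrences of the index [k] are replaced by [u].  Reduction starts from
   closed terms and never goes under a binder, so [u] is always closed and [k]
   is the only free index: neither shifting nor renumbering is needed. *)
Fixpoint lsubst (s : lterm) (k : nat) (u : lterm) : lterm :=
  match s with
  | LVar n => if n == k then u else LVar n
  | LApp s1 s2 => LApp (lsubst s1 k u) (lsubst s2 k u)
  | LLam s1 => LLam (lsubst s1 k.+1 u)
  end.

Inductive lstep : lterm -> lterm -> Prop :=
| lstep_beta s t : lstep (LApp (LLam s) (LLam t)) (lsubst s 0 (LLam t))
| lstep_appl s s' t : lstep s s' -> lstep (LApp s t) (LApp s' t)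
| lstep_appr s t t' : lstep t t' -> lstep (LApp s t) (LApp s t').

Definition lred : lterm -> lterm -> Prop := clos_refl_trans_1n lterm lstep.

Fixpoint bounded (k : nat) (s : lterm) : bool :=
  match s with
  | LVar n => n < k
  | LApp s1 s2 => bounded k s1 && bounded k s2
  | LLam s1 => bounded k.+1 s1
  end.

Definition lclosed (s : lterm) : bool := bounded 0 s.

(* Scott encodings of the data: a constructor with [m] arguments [x1 ... xm],
   the [i]-th among [n], is [fun f_0 ... f_(n-1) => f_i x1 ... xm]. *)

Definition ltrue : lterm := LLam (LLam (LVar 1)).
Definition lfalse : lterm := LLam (LLam (LVar 0)).

Fixpoint code_nat (n : nat) : lterm :=
  match n with
  | 0 => LLam (LLam (LVar 1))
  | n'.+1 => LLam (LLam (LApp (LVar 0) (code_nat n')))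
  end.

Definition lam5 (s : lterm) : lterm := LLam (LLam (LLam (LLam (LLam s)))).

Fixpoint code_term (a : term) : lterm :=
  match a with
  | Var n => lam5 (LApp (LVar 4) (code_nat n))
  | Bot => lam5 (LVar 3)
  | Neg b => lam5 (LApp (LVar 2) (code_term b))
  | And b c => lam5 (LApp (LApp (LVar 1) (code_term b)) (code_term c))
  | Or b c => lam5 (LApp (LApp (LVar 0) (code_term b)) (code_term c))
  end.

Fixpoint code_list (l : seq term) : lterm :=
  match l with
  | [::] => LLam (LLam (LVar 1))
  | a :: l' => LLam (LLam (LApp (LApp (LVar 0) (code_term a)) (code_list l')))
  end.

Definition code_pair (s t : lterm) : lterm :=
  LLam (LApp (LApp (LVar 0) s) t).

(* A finite multiset is presented to a program by any list of its elements,
   in any order and counted with multiplicity. *)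
Definition codes_sequent (s : sequent) (c : lterm) : Prop :=
  exists2 l : seq term,
    seq_mset l = s.1 & c = code_pair (code_list l) (code_term s.2).

Lemma codes_sequent_total (s : sequent) : exists c, codes_sequent s c.
Proof.
exists (code_pair (code_list (enum_mset s.1)) (code_term s.2)).
by exists (enum_mset s.1) => //; exact: seq_mset_id.
Qed.

(* One program answers correctly on every code of every input. *)
Definition algorithmically_decidable (X : Type) (codes : X -> lterm -> Prop)
    (P : X -> Prop) : Prop :=
  exists t : lterm, lclosed t /\
    forall (x : X) (c : lterm), codes x c ->
      (P x /\ lred (LApp t c) ltrue) \/ (~ P x /\ lred (LApp t c) lfalse).

(* Main.v *)
From mathcomp Require Import all_boot finmap multiset.
From Stdlib Require Import Relation_Operators.
Require Import Defs.

Set Implicit Arguments.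
Unset Strict Implicit.
Unset Printing Implicit Defensive.

(** The calculus is decided by one deterministic root-first search.  All left
    rules are invertible, so the formulas on the left can be decomposed one
    after the other until each branch has only literals ([Var n] or
    [Neg (Var n)]) on the left, or contains [Bot] and is closed.  Each rule
    replaces a formula by subformulas or negated subformulas, so this is a
    structural recursion on signed formulas.  On a branch with a set [E] of
    literals, the succedent is derivable exactly when it evaluates to true in
    [E], a literal being true if it belongs to [E].

    Soundness ([derivable_sound]) turns an accepting run into a derivation,
    clause by clause.  Completeness does not use invertibility but valuations:
    sets of literals are four-valued valuations, for which the calculus is sound
    ([G3DM_holds]); each branch ends in a valuation that satisfies the whole left
    side, so it satisfies the succedent of a derivable sequent.

    The procedure is then carried over to the lambda-calculus.  A term realizes
    a function if it maps realizers of arguments to realizers of values, data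
    being realized by their Scott codes ([realizes], [fun_rep]).  The
    search, written in continuation-passing style, and the evaluation are two
    instances of one fold over signed formulas, which is translated once
    ([realizes_nnf_fold]); as lambda-terms are untyped, sets
    of literals and continuations are passed as functions and need no encoding as
    data. *)

(** * The decision procedure *)

(** Recursion along the negation normal form of [a] (for [p = true]) or of
    [Neg a] (for [p = false]), without building that form: the calculus has a
    rule for each connective and a dual one for its negation, and carrying the
    sign [p] makes the recursion structural in [a]. *)
Fixpoint nnf_fold (X : Type) (lit : nat -> bool -> X) (bot top : X)
    (conj disj : X -> X -> X) (a : term) (p : bool) : X :=
  let fold := nnf_fold lit bot top conj disj in
  match a with
  | Var n => lit n p
  | Bot => if p then bot else top
  | Neg b => fold b (~~ p)
  | And b c => if p then conj (fold b p) (fold c p)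
               else disj (fold b p) (fold c p)
  | Or b c => if p then disj (fold b p) (fold c p)
              else conj (fold b p) (fold c p)
  end.

Definition signed (a : term) (p : bool) : term := if p then a else Neg a.

(** A set of literals, [E n p] telling whether [signed (Var n) p] is in it.  It
    is also a four-valued valuation: [E n true] and [E n false] are independent,
    so a variable may be both true and false, or neither. *)
Definition env : Type := nat -> bool -> bool.

Definition no_literal : env := fun _ _ => false.

(** [if p then q else ~~ q] is the test [p == q], in the form in which the
   lambda-program performs it. *)
Definition add_literal (n : nat) (p : bool) (E : env) : env :=
  fun m q => (m == n) && (if p then q else ~~ q) || E m q.

Definition holds : term -> bool -> env -> bool :=
  nnf_fold (fun n p E => E n p) (fun _ => false) (fun _ => true)
    (fun x y E => x E && y E) (fun x y E => x E || y E).

(** The left-hand side is decomposed in continuation-passing style: a search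
    receives the literals found so far and the test [K] that every branch of the
    rest of the derivation has to pass.  A rule with two premises branches, a
    rule which adds two formulas chains two searches. *)
Definition search : Type := (env -> bool) -> (env -> bool).

Definition skip : search := fun K => K.
Definition close : search := fun _ _ => true.
Definition record_literal (n : nat) (p : bool) : search :=
  fun K E => K (add_literal n p E).
Definition seq_search (x y : search) : search := fun K => x (y K).
Definition par_search (x y : search) : search := fun K E => x K E && y K E.

Definition decompose : term -> bool -> search :=
  nnf_fold record_literal close skip seq_search par_search.

Fixpoint decompose_all (l : seq term) : search :=
  match l with
  | [::] => skip
  | a :: l' => seq_search (decompose a true) (decompose_all l')
  end.

(** The left rules are invertible, so they may be applied until only literals
    remain on the left, apart from [Neg Bot], which is always true; from literals,
    the right rules alone suffice, and they evaluate the succedent in the set of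
    these literals. *)
Definition derivable (l : seq term) (a : term) : bool :=
  decompose_all l (holds a true) no_literal.

Local Open Scope mset_scope.
Local Open Scope sequent_scope.

(** * Correctness of the procedure *)

Definition supported (E : env) (S : structure) : Prop :=
  forall n p, E n p -> signed (Var n) p \in S.

Lemma supported_add1 E S a : supported E S -> supported E (a +` S).
Proof. by move=> ES n p /ES; rewrite in_msetD => ->; rewrite orbT. Qed.

Lemma supported_add_literal E S n p :
  supported E S -> supported (add_literal n p E) (signed (Var n) p +` S).
Proof.
move=> ES m q; rewrite in_msetD in_mset1 => /orP[/andP[/eqP-> pq]|/ES->].
  by case: p pq; case: q => // _; rewrite eqxx.
by rewrite orbT.
Qed.

Lemma mset_mem_split (a : term) (S : structure) :
  a \in S -> exists S', S = a +` S'.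
Proof. by move=> aS; exists (S `\ a); rewrite msetB1K. Qed.

(** Evaluation to true is a derivation by right rules only. *)
Lemma holds_derivable E S a p :
  supported E S -> holds a p E -> G3DM (S =>> signed a p).
Proof.
move=> ES; rewrite /holds; elim: a p => [n||a IHa|a IHa b IHb|a IHa b IHb] p /=.
- move/ES => /mset_mem_split[S' ->]; case: p => /=; [exact: ax_var|exact: ax_neg_var].
- by case: p => //= _; exact: ax_neg_bot.
- by case: p => /= /IHa //; exact: neg_neg_right.
- case: p => /= [/andP[/IHa ? /IHb ?]|/orP[/IHa|/IHb]].
  + exact: and_right.
  + exact: neg_and_right1.
  + exact: neg_and_right2.
- case: p => /= [/orP[/IHa|/IHb]|/andP[/IHa ? /IHb ?]].
  + exact: or_right1.
  + exact: or_right2.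
  + exact: neg_or_right.
Qed.

(** [D] collects the formulas that the continuation [K] still has to decompose.
    Stating the soundness of [K] relative to them is what lets [seq_search]
    compose. *)
Definition proves (K : env -> bool) (D : structure) (c : term) : Prop :=
  forall E S, supported E S -> K E -> G3DM (D `+` S =>> c).

(** Each clause of [decompose] for a connective or its negation is a left rule,
    read upwards. *)
Lemma decompose_proves a p K D c :
  proves K D c -> proves (decompose a p K) (signed a p +` D) c.
Proof.
rewrite /decompose.
elim: a p K D => [n||a IHa|a IHa b IHb|a IHa b IHb] p K D KD E S ES /=.
- rewrite /record_literal => /KD; rewrite -msetDA msetDCA; apply.
  exact: supported_add_literal.
- case: p => /= [_|KE]; first by rewrite -msetDA; exact: ax_bot.
  (* [Neg Bot] has no left rule: it stays in the context, which [supported]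
     allows. *)
  by rewrite -msetDA msetDCA; apply: KD KE; exact: supported_add1.
- case: p => /= KE; first by have := IHa false K D KD E S ES KE.
  by rewrite -msetDA; apply: neg_neg_left; rewrite msetDA; exact: IHa KE.
- case: p => /=; rewrite /seq_search /par_search.
    move=> KE; rewrite -msetDA; apply: and_left; rewrite !msetDA -(msetDA [mset a]).
    by apply: IHa ES KE; exact: IHb.
  by case/andP=> Ka Kb; rewrite -msetDA; apply: neg_and_left; rewrite msetDA;
    [exact: IHa Ka|exact: IHb Kb].
- case: p => /=; rewrite /seq_search /par_search.
    by case/andP=> Ka Kb; rewrite -msetDA; apply: or_left; rewrite msetDA;
      [exact: IHa Ka|exact: IHb Kb].
  move=> KE; rewrite -msetDA; apply: neg_or_left; rewrite !msetDA -(msetDA [mset Neg a]).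
  by apply: (IHa false) ES KE; exact: (IHb false).
Qed.

Lemma decompose_all_proves l K c :
  proves K mset0 c -> proves (decompose_all l K) (seq_mset l) c.
Proof.
move=> K0; elim: l => [|a l IHl] /=.
  by rewrite (_ : seq_mset [::] = mset0) //; apply/msetP => b; rewrite mset_seqE mset0E.
rewrite mset_cons; exact: (@decompose_proves a true).
Qed.

Lemma derivable_sound l a : derivable l a -> G3DM (seq_mset l =>> a).
Proof.
move=> d; rewrite -[seq_mset l]msetD0.
apply: decompose_all_proves d => // E S ES; rewrite mset0D.
exact: (@holds_derivable E S a true).
Qed.

(** Soundness of the calculus for four-valued valuations: a derivable sequent
    cannot have true premises and a succedent that is not true. *)
Lemma G3DM_holds s E : G3DM s ->
  (forall a, a \in s.1 -> holds a true E) -> holds s.2 true E.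
Proof.
have cons_holds a (S : structure) : (forall b, b \in a +` S -> holds b true E) <->
    holds a true E /\ (forall b, b \in S -> holds b true E).
  split=> [aS|[Ea ES] b].
    by split=> [|b bS]; apply: aS; rewrite in_msetD in_mset1 ?eqxx ?bS ?orbT.
  by rewrite in_msetD in_mset1 => /orP[/eqP->|/ES].
elim=> {s} /=.
- by move=> p S /cons_holds[].
- by move=> p S /cons_holds[].
- by move=> S a /cons_holds[].
- by [].
- move=> a b c S _ IH /cons_holds[/andP[Ea Eb] ES]; apply: IH.
  by apply/cons_holds; split=> //; apply/cons_holds.
- by move=> a b S _ IHa _ IHb ES; apply/andP; split; [exact: IHa|exact: IHb].
- move=> a b c S _ IHa _ IHb /cons_holds[/orP[Ea|Eb] ES]; [apply: IHa|apply: IHb];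
    by apply/cons_holds.
- by move=> a b S _ IH ES; apply/orP; left; exact: IH.
- by move=> a b S _ IH ES; apply/orP; right; exact: IH.
- move=> a b c S _ IHa _ IHb /cons_holds[/orP[Ea|Eb] ES]; [apply: IHa|apply: IHb];
    by apply/cons_holds.
- by move=> a b S _ IH ES; apply/orP; left; exact: IH.
- by move=> a b S _ IH ES; apply/orP; right; exact: IH.
- move=> a b c S _ IH /cons_holds[/andP[Ea Eb] ES]; apply: IH.
  by apply/cons_holds; split=> //; apply/cons_holds.
- by move=> a b S _ IHa _ IHb ES; apply/andP; split; [exact: IHa|exact: IHb].
- by move=> a c S _ IH /cons_holds[Ea ES]; apply: IH; apply/cons_holds.
- by [].
Qed.

Definition env_le (E E' : env) : Prop := forall n p, E n p -> E' n p.

Lemma holds_mono a p E E' : env_le E E' -> holds a p E -> holds a p E'.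
Proof.
move=> EE'; rewrite /holds; elim: a p => [n||a IHa|a IHa b IHb|a IHa b IHb] p /=.
- exact: EE'.
- by case: p.
- exact: IHa.
- by case: p => /= [/andP[/IHa-> /IHb->]|/orP[/IHa->|/IHb->]]; rewrite ?orbT.
- by case: p => /= [/orP[/IHa->|/IHb->]|/andP[/IHa-> /IHb->]]; rewrite ?orbT.
Qed.

(** The literals collected on a branch are true in the set in which the branch
    ends, and [holds] is monotone, so each decomposed formula holds there: a
    test [K] that accepts every extension of [E] where [signed a p] holds
    accepts every branch. *)
Lemma decompose_complete a p (K : env -> bool) E :
  (forall E', env_le E E' -> holds a p E' -> K E') -> decompose a p K E.
Proof.
rewrite /decompose.
elim: a p K E => [n||a IHa|a IHa b IHb|a IHa b IHb] p K E KE /=.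
- apply: KE => [m q Emq|]; first by rewrite /add_literal Emq orbT.
  by rewrite /holds /= /add_literal eqxx; case: p.
- by case: p KE => KE //; apply: KE => // n q.
- exact: IHa.
- case: p KE => KE.
    apply: IHa => E1 EE1 Ea; apply: IHb => E2 EE2 Eb.
    apply: KE => [n q /EE1/EE2|] //; apply/andP; split=> //.
    exact: holds_mono Ea.
  by apply/andP; split; [apply: IHa|apply: IHb] => E' EE' h;
    apply: KE => //; apply/orP; [left|right].
- case: p KE => KE.
    by apply/andP; split; [apply: IHa|apply: IHb] => E' EE' h;
      apply: KE => //; apply/orP; [left|right].
  apply: IHa => E1 EE1 Ea; apply: IHb => E2 EE2 Eb.
  apply: KE => [n q /EE1/EE2|] //; apply/andP; split=> //.
  exact: holds_mono Ea.
Qed.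

Lemma decompose_all_complete l (K : env -> bool) E :
  (forall E', env_le E E' -> {in l, forall a, holds a true E'} -> K E') ->
  decompose_all l K E.
Proof.
elim: l K E => [|a l IHl] K E KE /=; first by apply: KE.
apply: decompose_complete => E1 EE1 Ea; apply: IHl => E2 EE2 El.
apply: KE => [n q /EE1/EE2|] // b; rewrite inE => /predU1P[->|/El] //.
exact: holds_mono Ea.
Qed.

Lemma derivableP l a : reflect (G3DM (seq_mset l =>> a)) (derivable l a).
Proof.
apply: (iffP idP) => [|d]; first exact: derivable_sound.
apply: decompose_all_complete => E _ El; apply: (G3DM_holds d) => b.
by rewrite /= (perm_mem (perm_eq_seq_mset l)) => /El.
Qed.

(** * Reduction of lambda-terms *)

Definition closed (s : lterm) : Prop := forall k u, lsubst s k u = s.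

Definition lvalue (s : lterm) : Prop := closed s /\ exists b, s = LLam b.

Lemma lvalue_closed s : lvalue s -> closed s. Proof. by case. Qed.

Lemma lred_trans s t u : lred s t -> lred t u -> lred s u.
Proof.
elim=> // x y z xy _ IH zu; exact: rt1n_trans xy (IH zu).
Qed.

Lemma lred_step s t : lstep s t -> lred s t.
Proof. by move=> st; exact: rt1n_trans st (rt1n_refl _ _ _). Qed.

Lemma lred_app s s' t t' : lred s s' -> lred t t' -> lred (LApp s t) (LApp s' t').
Proof.
move=> ss tt; apply: (@lred_trans _ (LApp s' t)).
  elim: ss => [x|x y z xy _ IH]; first exact: rt1n_refl.
  by apply: rt1n_trans IH; exact: lstep_appl.
elim: tt => [x|x y z xy _ IH]; first exact: rt1n_refl.
by apply: rt1n_trans IH; exact: lstep_appr.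
Qed.

Lemma lred_appl s s' t : lred s s' -> lred (LApp s t) (LApp s' t).
Proof. by move=> /lred_app; apply; exact: rt1n_refl. Qed.

Lemma lred_beta b v : lvalue v -> lred (LApp (LLam b) v) (lsubst b 0 v).
Proof. by case=> _ [c ->]; apply: lred_step; exact: lstep_beta. Qed.

(** * Realizability *)

Definition lrep (X : Type) : Type := lterm -> X -> Prop.

(** [s] evaluates to a value that represents [x].  Together with [fun_rep], this
    is a logical relation: programs are verified by following their syntax, as
    in a typing derivation, and never by computing with substitutions by hand. *)
Definition realizes (X : Type) (R : lrep X) (s : lterm) (x : X) : Prop :=
  exists v, [/\ lred s v, lvalue v & R v x].

Definition fun_rep (X Y : Type) (R : lrep X) (S : lrep Y) : lrep (X -> Y) :=
  fun v f => forall u x, lvalue u -> R u x -> realizes S (LApp v u) (f x).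

Definition code_bool (b : bool) : lterm := if b then ltrue else lfalse.

Definition data_rep (X : Type) (code : X -> lterm) : lrep X :=
  fun v x => v = code x.

Notation "R ~> S" := (fun_rep R S) (at level 65, right associativity).
Notation bool_rep := (data_rep code_bool).
Notation nat_rep := (data_rep code_nat).
Notation term_rep := (data_rep code_term).
Notation list_rep := (data_rep code_list).

Lemma realizes_value X (R : lrep X) v x : lvalue v -> R v x -> realizes R v x.
Proof. by move=> vv Rvx; exists v; split=> //; exact: rt1n_refl. Qed.

Lemma realizes_expand X (R : lrep X) s t x :
  lred s t -> realizes R t x -> realizes R s x.
Proof. by move=> st [v [tv vv Rv]]; exists v; split=> //; exact: lred_trans tv. Qed.

Lemma realizes_app X Y (R : lrep X) (S : lrep Y) s t f x :
  realizes (R ~> S) s f -> realizes R t x -> realizes S (LApp s t) (f x).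
Proof.
move=> [v [sv _ Rv]] [u [tu uv Ru]].
exact: realizes_expand (lred_app sv tu) (Rv u x uv Ru).
Qed.

Lemma realizes_lam X Y (R : lrep X) (S : lrep Y) b f :
  closed (LLam b) ->
  (forall u x, lvalue u -> realizes R u x -> realizes S (lsubst b 0 u) (f x)) ->
  realizes (R ~> S) (LLam b) f.
Proof.
move=> cb fb; apply: realizes_value; first by split=> //; exists b.
move=> u x uv Ru; apply: realizes_expand (lred_beta b uv) _.
by apply: fb => //; exact: realizes_value.
Qed.

(** * Evaluation of encoded data *)

(* Pushing substitutions is driven by the syntax of the term, so that the named
   closed terms are kept folded and recognized as closed by [lvalues]. *)
Ltac simp_lsubst :=
  repeat match goal with
  | |- context [lsubst ?s ?k ?u] =>
      lazymatch s with
      | LApp ?a ?b => change (lsubst s k u) with (LApp (lsubst a k u) (lsubst b k u))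
      | LLam ?b => change (lsubst s k u) with (LLam (lsubst b k.+1 u))
      | LVar ?n => let v := eval compute in (n == k) in
          lazymatch v with
          | true => change (lsubst s k u) with u
          | false => change (lsubst s k u) with s
          end
      | _ => rewrite (_ : lsubst s k u = s);
          last solve [apply: lvalue_closed; auto with lvalues]
      end
  end.

Ltac solve_closed := by move=> ? ?; simp_lsubst.

Lemma lvalue_lam b : closed (LLam b) -> lvalue (LLam b).
Proof. by split=> //; exists b. Qed.

Ltac solve_lvalue := apply: lvalue_lam; solve_closed.

Lemma lvalue_bool b : lvalue (code_bool b).
Proof. by case: b; rewrite /= /ltrue /lfalse; solve_lvalue. Qed.
#[local] Hint Resolve lvalue_bool : lvalues.

Lemma lvalue_true : lvalue ltrue. Proof. exact: (lvalue_bool true). Qed.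
Lemma lvalue_false : lvalue lfalse. Proof. exact: (lvalue_bool false). Qed.
#[local] Hint Resolve lvalue_true lvalue_false : lvalues.

Lemma lvalue_nat n : lvalue (code_nat n).
Proof. elim: n => [|n IHn] /=; solve_lvalue. Qed.
#[local] Hint Resolve lvalue_nat : lvalues.

Lemma lvalue_term a : lvalue (code_term a).
Proof. elim: a => [n||a IHa|a IHa b IHb|a IHa b IHb]; rewrite /= /lam5; solve_lvalue. Qed.
#[local] Hint Resolve lvalue_term : lvalues.

Lemma lvalue_list l : lvalue (code_list l).
Proof. elim: l => [|a l IHl] /=; solve_lvalue. Qed.
#[local] Hint Resolve lvalue_list : lvalues.

Ltac beta :=
  eapply lred_trans;
  [solve [repeat (solve [apply lred_beta; auto with lvalues] || apply lred_appl)]|];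
  simp_lsubst.

Lemma code_bool_case b u v : lvalue u -> lvalue v ->
  lred (LApp (LApp (code_bool b) u) v) (if b then u else v).
Proof.
by move=> uv vv; case: b; rewrite /= /ltrue /lfalse; do 2![beta]; exact: rt1n_refl.
Qed.

Lemma code_nat_case n u v : lvalue u -> lvalue v ->
  lred (LApp (LApp (code_nat n) u) v)
       (if n is n'.+1 then LApp v (code_nat n') else u).
Proof. move=> uv vv; case: n => [|n] /=; do 2![beta]; exact: rt1n_refl. Qed.

Lemma code_list_case l u v : lvalue u -> lvalue v ->
  lred (LApp (LApp (code_list l) u) v)
       (if l is a :: l' then LApp (LApp v (code_term a)) (code_list l') else u).
Proof. move=> uv vv; case: l => [|a l] /=; do 2![beta]; exact: rt1n_refl. Qed.

Lemma code_term_case a vvar vbot vneg vand vor :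
  lvalue vvar -> lvalue vbot -> lvalue vneg -> lvalue vand -> lvalue vor ->
  lred (LApp (LApp (LApp (LApp (LApp (code_term a) vvar) vbot) vneg) vand) vor)
    (match a with
     | Var n => LApp vvar (code_nat n)
     | Bot => vbot
     | Neg b => LApp vneg (code_term b)
     | And b c => LApp (LApp vand (code_term b)) (code_term c)
     | Or b c => LApp (LApp vor (code_term b)) (code_term c)
     end).
Proof.
move=> ? ? ? ? ?; case: a => [n||b|b c|b c]; rewrite /= /lam5; do 5![beta]; exact: rt1n_refl.
Qed.

Lemma realizes_lred X (code : X -> lterm) s x :
  realizes (data_rep code) s x -> lred s (code x).
Proof. by case=> v [sv _ <-]. Qed.

(** * Realizers of the basic constructions *)

(** Both branches are evaluated before the choice, which is harmless because
    all realizers terminate. *)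
Lemma realizes_bool_case X (R : lrep X) s t u b x y :
  realizes bool_rep s b -> realizes R t x -> realizes R u y ->
  realizes R (LApp (LApp s t) u) (if b then x else y).
Proof.
move=> rs [v [tv vv Rv]] [w [uw vw Rw]].
apply: realizes_expand (lred_app (lred_app (realizes_lred rs) tv) uw) _.
apply: realizes_expand (code_bool_case b vv vw) _.
by case: b {rs}; apply: realizes_value.
Qed.

Lemma realizes_nat_case X (R : lrep X) s n u v x :
  realizes nat_rep s n -> lvalue u -> lvalue v ->
  realizes R (if n is n'.+1 then LApp v (code_nat n') else u) x ->
  realizes R (LApp (LApp s u) v) x.
Proof.
move=> rs uv vv; apply: realizes_expand.
apply: lred_trans (code_nat_case n uv vv).
by do 2![apply: lred_appl]; exact: realizes_lred.
Qed.

Lemma realizes_data X (code : X -> lterm) x :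
  lvalue (code x) -> realizes (data_rep code) (code x) x.
Proof. by move=> v; exact: realizes_value. Qed.

Lemma realizes_true : realizes bool_rep ltrue true.
Proof. exact: (realizes_data (lvalue_bool true)). Qed.
Lemma realizes_false : realizes bool_rep lfalse false.
Proof. exact: (realizes_data (lvalue_bool false)). Qed.
#[local] Hint Resolve realizes_true realizes_false : realizers.

Lemma realizes_neg s b :
  realizes bool_rep s b -> realizes bool_rep (LApp (LApp s lfalse) ltrue) (~~ b).
Proof. by move=> sb; apply: (realizes_bool_case sb); auto with realizers. Qed.

Lemma realizes_and s t b c :
  realizes bool_rep s b -> realizes bool_rep t c ->
  realizes bool_rep (LApp (LApp s t) lfalse) (b && c).
Proof. by move=> sb tc; apply: (realizes_bool_case sb); auto with realizers. Qed.

Lemma realizes_or s t b c :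
  realizes bool_rep s b -> realizes bool_rep t c ->
  realizes bool_rep (LApp (LApp s ltrue) t) (b || c).
Proof. by move=> sb tc; apply: (realizes_bool_case sb); auto with realizers. Qed.

(* Driven by the head of the realized function; [realizes_app] comes last since
   the realizers of the boolean connectives are applications too. *)
Ltac realize_body :=
  repeat first
    [ eassumption
    | solve [auto with realizers]
    | match goal with
      | |- realizes _ _ (~~ _) => apply: realizes_neg
      | |- realizes _ _ (_ && _) => apply: realizes_and
      | |- realizes _ _ (_ || _) => apply: realizes_or
      | |- realizes _ _ (if _ then _ else _) => apply: realizes_bool_case
      end
    | eapply realizes_app ].

Ltac realize_beta :=
  apply: realizes_expand; [by beta; exact: rt1n_refl|].

Ltac realize_lam :=
  apply: realizes_lam; [solve_closed | intros; simp_lsubst].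

Ltac realize := repeat realize_lam; realize_body.

(** A call-by-value fixed point by self-application.  The eta-expansions keep
    [lrec f] a value and delay the unfolding until an argument arrives. *)
Definition lrec (f : lterm) : lterm :=
  let w := LLam (LApp f (LLam (LApp (LApp (LVar 1) (LVar 1)) (LVar 0)))) in
  LLam (LApp (LApp w w) (LVar 0)).

Lemma lvalue_lrec f : lvalue f -> lvalue (lrec f).
Proof. move=> fv; rewrite /lrec; solve_lvalue. Qed.
#[local] Hint Resolve lvalue_lrec : lvalues.

Lemma lrec_unfold f b u : f = LLam (LLam b) -> lvalue f -> lvalue u ->
  lred (LApp (lrec f) u) (lsubst (lsubst b 1 (lrec f)) 0 u).
Proof.
move=> fE fv uv.
have wv : lvalue (LLam (LApp f (LLam (LApp (LApp (LVar 1) (LVar 1)) (LVar 0))))).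
  solve_lvalue.
apply: (@lred_trans _ (LApp (LApp f (lrec f)) u)).
  by rewrite /lrec; do 2![beta]; exact: rt1n_refl.
have rv := lvalue_lrec fv; rewrite {1}fE.
by beta; exact: lred_beta.
Qed.

Lemma realizes_lrec X Y (code : X -> lterm) (S : lrep Y) f g :
  lvalue f -> (forall x, realizes S (LApp (lrec f) (code x)) (g x)) ->
  realizes (data_rep code ~> S) (lrec f) g.
Proof.
move=> fv fg; apply: realizes_value; first exact: lvalue_lrec.
by move=> u x _ ->.
Qed.

(** * The program *)

(* Under the two outer binders of the bodies given to [lrec], index 0 is the
   argument, on which the body branches, and index 1 the recursive function. *)
Definition lnat_eq_body : lterm :=
  LLam (LLam (LApp (LApp (LVar 0)
    (LLam (LApp (LApp (LVar 0) ltrue) (LLam lfalse))))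
    (LLam (LLam (LApp (LApp (LVar 0) lfalse)
       (LLam (LApp (LApp (LVar 4) (LVar 2)) (LVar 0)))))))).

Lemma lvalue_nat_eq_body : lvalue lnat_eq_body.
Proof. rewrite /lnat_eq_body; solve_lvalue. Qed.
#[local] Hint Resolve lvalue_nat_eq_body : lvalues.

Definition lnat_eq : lterm := lrec lnat_eq_body.

Lemma lvalue_nat_eq : lvalue lnat_eq.
Proof. exact: lvalue_lrec lvalue_nat_eq_body. Qed.
#[local] Hint Resolve lvalue_nat_eq : lvalues.

Lemma realizes_code_nat n : realizes nat_rep (code_nat n) n.
Proof. exact: realizes_data (lvalue_nat n). Qed.
Lemma realizes_code_term a : realizes term_rep (code_term a) a.
Proof. exact: realizes_data (lvalue_term a). Qed.
Lemma realizes_code_list l : realizes list_rep (code_list l) l.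
Proof. exact: realizes_data (lvalue_list l). Qed.
#[local] Hint Resolve realizes_code_nat realizes_code_term realizes_code_list : realizers.

Lemma realizes_nat_eq :
  realizes (nat_rep ~> nat_rep ~> bool_rep) lnat_eq (fun m n => m == n).
Proof.
apply: realizes_lrec => [|m]; first exact: lvalue_nat_eq_body.
elim: m => [|m IHm];
  apply: (realizes_expand (lrec_unfold erefl lvalue_nat_eq_body (lvalue_nat _)));
  simp_lsubst; apply: realizes_nat_case (realizes_code_nat _) _ _ _;
  try solve_lvalue.
- apply: realizes_lam => [|v n vv vn]; [solve_closed|simp_lsubst].
  apply: (realizes_nat_case vn); try solve_lvalue.
  case: n {vn} => [|n]; first exact: realizes_true.
  by realize_beta; exact: realizes_false.
realize_beta.
apply: realizes_lam => [|v n vv vn]; [solve_closed|simp_lsubst].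
apply: (realizes_nat_case vn); try solve_lvalue.
case: n {vn} => [|n]; first exact: realizes_false.
realize_beta.
by apply: (realizes_app IHm); auto with realizers.
Qed.
#[local] Hint Resolve realizes_nat_eq : realizers.

Notation env_rep := (nat_rep ~> bool_rep ~> bool_rep).
Notation search_rep := ((env_rep ~> bool_rep) ~> (env_rep ~> bool_rep)).

Definition ladd_literal : lterm :=
  LLam (LLam (LLam (LLam (LLam
    (LApp (LApp
      (LApp (LApp (LApp (LApp lnat_eq (LVar 1)) (LVar 4))
         (LApp (LApp (LVar 3) (LVar 0)) (LApp (LApp (LVar 0) lfalse) ltrue)))
         lfalse)
      ltrue) (LApp (LApp (LVar 2) (LVar 1)) (LVar 0))))))).

Lemma lvalue_add_literal : lvalue ladd_literal.
Proof. rewrite /ladd_literal; solve_lvalue. Qed.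
#[local] Hint Resolve lvalue_add_literal : lvalues.

Lemma realizes_add_literal :
  realizes (nat_rep ~> bool_rep ~> env_rep ~> env_rep) ladd_literal add_literal.
Proof. rewrite /ladd_literal /add_literal; realize. Qed.
#[local] Hint Resolve realizes_add_literal : realizers.

Definition lskip : lterm := LLam (LVar 0).
Definition lclose : lterm := LLam (LLam ltrue).
Definition lrecord_literal : lterm :=
  LLam (LLam (LLam (LLam (LApp (LVar 1)
    (LApp (LApp (LApp ladd_literal (LVar 3)) (LVar 2)) (LVar 0)))))).
Definition lseq_search : lterm :=
  LLam (LLam (LLam (LApp (LVar 2) (LApp (LVar 1) (LVar 0))))).
Definition lpar_search : lterm :=
  LLam (LLam (LLam (LLam (LApp (LApp (LApp (LApp (LVar 3) (LVar 1)) (LVar 0))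
    (LApp (LApp (LVar 2) (LVar 1)) (LVar 0))) lfalse)))).

Lemma lvalue_skip : lvalue lskip.
Proof. rewrite /lskip; solve_lvalue. Qed.
Lemma lvalue_close : lvalue lclose.
Proof. rewrite /lclose; solve_lvalue. Qed.
Lemma lvalue_record_literal : lvalue lrecord_literal.
Proof. rewrite /lrecord_literal; solve_lvalue. Qed.
Lemma lvalue_seq_search : lvalue lseq_search.
Proof. rewrite /lseq_search; solve_lvalue. Qed.
Lemma lvalue_par_search : lvalue lpar_search.
Proof. rewrite /lpar_search; solve_lvalue. Qed.
#[local] Hint Resolve lvalue_skip lvalue_close lvalue_record_literal : lvalues.
#[local] Hint Resolve lvalue_seq_search lvalue_par_search : lvalues.

Lemma realizes_skip : realizes search_rep lskip skip.
Proof. rewrite /lskip; realize. Qed.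
Lemma realizes_close : realizes search_rep lclose close.
Proof. rewrite /lclose; realize. Qed.
Lemma realizes_record_literal :
  realizes (nat_rep ~> bool_rep ~> search_rep) lrecord_literal record_literal.
Proof. rewrite /lrecord_literal /record_literal; realize. Qed.
Lemma realizes_seq_search :
  realizes (search_rep ~> search_rep ~> search_rep) lseq_search seq_search.
Proof. rewrite /lseq_search /seq_search; realize. Qed.
Lemma realizes_par_search :
  realizes (search_rep ~> search_rep ~> search_rep) lpar_search par_search.
Proof. rewrite /lpar_search /par_search; realize. Qed.

Definition lnnf_fold_body (lit bot top conj disj : lterm) : lterm :=
  let self_b := LApp (LApp (LVar 4) (LVar 2)) (LVar 0) in
  let self_c := LApp (LApp (LVar 4) (LVar 1)) (LVar 0) in
  let lconj := LApp (LApp conj self_b) self_c in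
  let ldisj := LApp (LApp disj self_b) self_c in
  LLam (LLam (LApp (LApp (LApp (LApp (LApp (LVar 0)
    (LLam (LApp lit (LVar 0))))
    (LLam (LApp (LApp (LVar 0) bot) top)))
    (LLam (LLam (LApp (LApp (LVar 3) (LVar 1))
                   (LApp (LApp (LVar 0) lfalse) ltrue)))))
    (LLam (LLam (LLam (LApp (LApp (LVar 0) lconj) ldisj)))))
    (LLam (LLam (LLam (LApp (LApp (LVar 0) ldisj) lconj)))))).

Lemma lvalue_nnf_fold_body lit bot top conj disj :
  lvalue lit -> lvalue bot -> lvalue top -> lvalue conj -> lvalue disj ->
  lvalue (lnnf_fold_body lit bot top conj disj).
Proof. by move=> *; rewrite /lnnf_fold_body; solve_lvalue. Qed.

(** The five parameters are closed values, so they can be plugged into the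
    program without shifting; the induction on the term is the termination proof
    of the recursive program. *)
Lemma realizes_nnf_fold (X : Type) (R : lrep X) (lit bot top conj disj : lterm)
    (flit : nat -> bool -> X) (fbot ftop : X) (fconj fdisj : X -> X -> X) :
  lvalue lit -> lvalue bot -> lvalue top -> lvalue conj -> lvalue disj ->
  realizes (nat_rep ~> bool_rep ~> R) lit flit ->
  realizes R bot fbot -> realizes R top ftop ->
  realizes (R ~> R ~> R) conj fconj -> realizes (R ~> R ~> R) disj fdisj ->
  realizes (term_rep ~> bool_rep ~> R)
    (lrec (lnnf_fold_body lit bot top conj disj))
    (nnf_fold flit fbot ftop fconj fdisj).
Proof.
move=> vlit vbot vtop vconj vdisj rlit rbot rtop rconj rdisj.
have fv := lvalue_nnf_fold_body vlit vbot vtop vconj vdisj.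
apply: realizes_lrec => // a.
elim: a => [n||a IHa|a IHa b IHb|a IHa b IHb];
  apply: (realizes_expand (lrec_unfold erefl fv (lvalue_term _))); simp_lsubst;
  (apply: realizes_expand; first by apply: code_term_case; solve_lvalue).
- by realize_beta; exact: (realizes_app rlit (realizes_code_nat n)).
- by realize_lam; rewrite /=; realize.
- by realize_beta; realize_lam; rewrite /=; realize.
- by do 2![realize_beta]; realize_lam; rewrite /=; realize.
- by do 2![realize_beta]; realize_lam; rewrite /=; realize.
Qed.

Definition ldecompose : lterm :=
  lrec (lnnf_fold_body lrecord_literal lclose lskip lseq_search lpar_search).

Lemma realizes_decompose :
  realizes (term_rep ~> bool_rep ~> search_rep) ldecompose decompose.
Proof.
apply: realizes_nnf_fold; auto with lvalues.
- exact: realizes_record_literal.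
- exact: realizes_close.
- exact: realizes_skip.
- exact: realizes_seq_search.
- exact: realizes_par_search.
Qed.
#[local] Hint Resolve realizes_decompose : realizers.

Lemma lvalue_decompose : lvalue ldecompose.
Proof.
by apply/lvalue_lrec/lvalue_nnf_fold_body; auto with lvalues.
Qed.
#[local] Hint Resolve lvalue_decompose : lvalues.

Definition lholds_lit : lterm :=
  LLam (LLam (LLam (LApp (LApp (LVar 0) (LVar 2)) (LVar 1)))).
Definition lholds_conj : lterm :=
  LLam (LLam (LLam (LApp (LApp (LApp (LVar 2) (LVar 0))
    (LApp (LVar 1) (LVar 0))) lfalse))).
Definition lholds_disj : lterm :=
  LLam (LLam (LLam (LApp (LApp (LApp (LVar 2) (LVar 0)) ltrue)
    (LApp (LVar 1) (LVar 0))))).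

Definition lholds_body : lterm :=
  lnnf_fold_body lholds_lit (LLam lfalse) (LLam ltrue) lholds_conj lholds_disj.

Lemma lvalue_holds_body : lvalue lholds_body.
Proof.
apply: lvalue_nnf_fold_body;
  rewrite ?/lholds_lit ?/lholds_conj ?/lholds_disj; solve_lvalue.
Qed.

Definition lholds : lterm := lrec lholds_body.

Lemma lvalue_holds : lvalue lholds.
Proof. exact: lvalue_lrec lvalue_holds_body. Qed.
#[local] Hint Resolve lvalue_holds : lvalues.

Lemma realizes_holds :
  realizes (term_rep ~> bool_rep ~> env_rep ~> bool_rep) lholds holds.
Proof.
apply: realizes_nnf_fold;
  rewrite ?/lholds_lit ?/lholds_conj ?/lholds_disj; try solve_lvalue; realize.
Qed.
#[local] Hint Resolve realizes_holds : realizers.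

Definition ldecompose_all_body : lterm :=
  LLam (LLam (LApp (LApp (LVar 0) lskip)
    (LLam (LLam (LApp (LApp lseq_search (LApp (LApp ldecompose (LVar 1)) ltrue))
       (LApp (LVar 3) (LVar 0))))))).

Lemma lvalue_decompose_all_body : lvalue ldecompose_all_body.
Proof. rewrite /ldecompose_all_body; solve_lvalue. Qed.

Definition ldecompose_all : lterm := lrec ldecompose_all_body.

Lemma lvalue_decompose_all : lvalue ldecompose_all.
Proof. exact: lvalue_lrec lvalue_decompose_all_body. Qed.
#[local] Hint Resolve lvalue_decompose_all : lvalues.

Lemma realizes_decompose_all :
  realizes (list_rep ~> search_rep) ldecompose_all decompose_all.
Proof.
have fv := lvalue_decompose_all_body; apply: realizes_lrec => // l.
elim: l => [|a l IHl];
  apply: (realizes_expand (lrec_unfold erefl fv (lvalue_list _))); simp_lsubst;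
  (apply: realizes_expand;
     first by apply: code_list_case; [exact: lvalue_skip|solve_lvalue]).
- exact: realizes_skip.
- do 2![realize_beta]; apply: realizes_app IHl; apply: realizes_app.
    exact: realizes_seq_search.
  realize.
Qed.
#[local] Hint Resolve realizes_decompose_all : realizers.

Definition lno_literal : lterm := LLam (LLam lfalse).

Lemma lvalue_no_literal : lvalue lno_literal.
Proof. rewrite /lno_literal; solve_lvalue. Qed.
#[local] Hint Resolve lvalue_no_literal : lvalues.

Lemma realizes_no_literal : realizes env_rep lno_literal no_literal.
Proof. rewrite /lno_literal; realize. Qed.
#[local] Hint Resolve realizes_no_literal : realizers.

Definition lderivable : lterm :=
  LLam (LApp (LVar 0) (LLam (LLam
    (LApp (LApp (LApp ldecompose_all (LVar 1)) (LApp (LApp lholds (LVar 0)) ltrue))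
       lno_literal)))).

Lemma lderivable_correct l a :
  lred (LApp lderivable (code_pair (code_list l) (code_term a)))
       (code_bool (derivable l a)).
Proof.
apply: realizes_lred; rewrite /lderivable /code_pair.
have pv : lvalue (code_pair (code_list l) (code_term a)).
  rewrite /code_pair; solve_lvalue.
apply: realizes_expand; first by apply: lred_beta.
simp_lsubst.
apply: realizes_expand; first by apply: lred_beta; solve_lvalue.
simp_lsubst.
do 2![realize_beta]; rewrite /derivable; realize.
Qed.

Theorem theorem4p14 : algorithmically_decidable codes_sequent G3DM.
Proof.
exists lderivable; split=> // [[S a]] c [l /= <- ->].
have := lderivable_correct l a.
by case: derivableP => [d|nd] r; [left|right].
Qed.
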